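(* For any real numbers $\alpha, \beta > 0$ there exist positive integers $N_0$ and $d_0$, depending only on $\alpha$ and $\beta$, such that for every integer $N \ge N_0$ and all sets $E_1, E_2 \subset \mathbb{Z}_N$ with $|E_1| \ge \alpha N$ and $|E_2| \ge \beta N$ there exists a positive divisor $d$ of $N$ with $d \le d_0$ such that \[ d\,\mathbb{Z}_N \subset (E_1 - E_1)\cdot(E_2 - E_2). \]
   Context: $\mathbb{Z}_N = \mathbb{Z}/N\mathbb{Z}$ is the ring of integers modulo $N$. For $E \subset \mathbb{Z}_N$, $E - E = \{x - y \mid x,y \in E\}$; for $P,Q \subset \mathbb{Z}_N$, $P\cdot Q = \{pq \mid p \in P, q \in Q\}$, with all operations taken in $\mathbb{Z}_N$; and $d\,\mathbb{Z}_N = \{dx \mid x \in \mathbb{Z}_N\}$. *)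

(* Defs.v *)
From HB Require Import structures.
From mathcomp Require Import all_boot all_order all_algebra.

Set Implicit Arguments.
Unset Strict Implicit.
Unset Printing Implicit Defensive.

Import GRing.Theory Num.Theory.
Local Open Scope ring_scope.

Definition diff_set (V : finZmodType) (E : {set V}) : {set V} :=
  [set x - y | x in E, y in E].

Definition prod_set (A : finPzRingType) (P Q : {set A}) : {set A} :=
  [set p * q | p in P, q in Q].

Definition multiples (A : finPzRingType) (d : nat) : {set A} :=
  [set d%:R * x | x : A].

(* Main.v *)
Require Import Defs.
From HB Require Import structures.
From mathcomp Require Import all_boot all_order all_algebra.
From mathcomp Require Import reals zify.

Set Implicit Arguments.
Unset Strict Implicit.
Unset Printing Implicit Defensive.

Import Order.TTheory GRing.Theory Num.Theory.
Local Open Scope ring_scope.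

(** The divisor comes out of a Ramsey argument.

    Write D1 and D2 for the two difference sets.  If E has density greater
    than 1/n in a finite abelian group, then among any n points y_0, ...,
    y_(n-1) two have their difference in E - E, because the n translates of E
    cannot be disjoint ([diff_set_meets]).  Applied to the points 0, t, 2t, ...
    this shows that D1 contains k t for some 0 < k < n1, whatever t is.

    Colour each pair of integers a < b < M by such a k for t = M! / (b - a).
    There are at most n1 colours, so for M large in terms of n1 and n2 only,
    Ramsey's theorem ([Ramsey_pairs]) gives n2 integers all of whose pairs have
    the same colour k.  Given a target x, dilate these integers by (n1! / k) x
    and apply the first remark to E2: for some pair a < b of the clique,
    (b - a) (n1! / k) x lies in D2, while k M! / (b - a) lies in D1.  In their
    product both k and b - a cancel, leaving M! n1! x.  Hence D = M! n1!, which
    depends on the densities only, satisfies D A <= D1 D2 in every finite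
    commutative ring A ([multiples_in_prod_diff_set]).  In Z/NZ the multiples of
    D are those of gcd(N, D), a divisor of N that is at most D. *)

Lemma pigeonhole_colour (T : Type) (C : finType) (col : T -> C) (m : C -> nat)
    (s : seq T) :
  (\sum_(k : C) m k < size s)%N ->
  exists k, (m k <= size [seq y <- s | col y == k])%N.
Proof.
move=> hs; apply/existsP; apply: contraLR hs => /existsPn hn.
suff -> : size s = (\sum_(k : C) size [seq y <- s | col y == k])%N.
  by rewrite -leqNgt; apply: leq_sum => k _; rewrite ltnW // ltnNge hn.
elim: s {hn} => [|y s IH] /=; first by rewrite big1.
rewrite IH (bigD1 (col y)) //= [RHS](bigD1 (col y)) //= eqxx /= -addSn.
by congr addn; apply: eq_bigr => k /negbTE; rewrite eq_sym => ->.
Qed.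

(** Ramsey's theorem for pairs and finitely many colours, with a clique size
    [m k] prescribed for each colour.  Letting the sizes vary makes the
    induction on their sum work: fix the first vertex, keep the vertices joined
    to it by a popular colour k, and ask among them for a k-clique with one
    vertex fewer, which the fixed vertex completes. *)
Lemma Ramsey_pairs (T : eqType) (C : finType) (m : C -> nat) :
  exists M : nat, forall (c : T -> T -> C) (s : seq T), (M <= size s)%N ->
  exists k t, [/\ subseq t s, size t = m k & pairwise (fun a b => c a b == k) t].
Proof.
have [n] := ubnP (\sum_k m k)%N.
elim: n m => // n IH m; rewrite ltnS => hn.
have [/existsP[k /eqP mk0]|/existsPn m_gt0] := boolP [exists k, m k == 0%N].
  by exists 0%N => c s _; exists k, [::]; rewrite mk0 sub0seq.
(* (j == k) is read as 0 or 1: only the size for colour k drops by one. *)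
have hIH (k : C) : exists M : nat, forall (c : T -> T -> C) (s : seq T),
    (M <= size s)%N -> exists j t, [/\ subseq t s, size t = (m j - (j == k))%N
      & pairwise (fun a b => c a b == j) t].
  apply: IH; apply: leq_trans hn.
  rewrite (bigD1 k) //= [X in (_ < X)%N](bigD1 k) //= eqxx subn1 -addSn.
  rewrite prednK ?lt0n ?m_gt0 // leq_add2l.
  by apply: leq_sum => j _; rewrite leq_subr.
have {hIH}[M hM] := fin_all_exists hIH.
exists (\sum_k M k).+2 => c [|x s] //=; rewrite ltnS => hs.
have [k hk] := pigeonhole_colour (c x) hs.
have [j [t [st zt pt]]] := hM k c _ hk.
have sts : subseq t s := subseq_trans st (filter_subseq _ _).
have [jk|jk] := eqVneq j k; last first.
  exists j, t; split => //; last by rewrite zt (negbTE jk) subn0.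
  exact: subseq_trans sts (subseq_cons _ _).
exists j, (x :: t); split; rewrite /= ?eqxx //.
  by rewrite zt jk eqxx subn1 prednK // lt0n.
rewrite pt andbT jk; apply/allP => y /(mem_subseq st).
by rewrite mem_filter => /andP[].
Qed.

Lemma diff_setN (V : finZmodType) (E : {set V}) (v : V) :
  v \in diff_set E -> - v \in diff_set E.
Proof. by case/imset2P => x y xE yE ->; rewrite opprB; apply: imset2_f. Qed.

(** The map (i, u) |-> u + y i cannot be injective on 'I_n x E; since the
    difference set is symmetric, the two indices of a collision may be
    ordered. *)
Lemma diff_set_meets (V : finZmodType) (E : {set V}) (n : nat) (y : nat -> V) :
  (#|V| < n * #|E|)%N ->
  exists a b : nat, (a < b < n)%N /\ y b - y a \in diff_set E.
Proof.
move=> hV; pose f (p : 'I_n * V) := p.2 + y p.1.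
have /dinjectivePn[[a u] /setXP[_ /= uE]] :
    ~~ dinjectiveb f (mem (setX [set: 'I_n] E)).
  apply/negP => /dinjectiveP /card_in_imset him.
  have := max_card (mem (f @: setX [set: 'I_n] E)).
  by rewrite him cardsX cardsT card_ord leqNgt hV.
case=> [[b v]]; rewrite inE => /andP[ne /setXP[_ /= vE]]; rewrite /f /= => uv.
have dE : y b - y a \in diff_set E.
  have -> : y b - y a = u - v.
    by rewrite -[u](addrK (y a)) uv [v + _]addrC addrAC addrK.
  exact: imset2_f.
have [ab|ba|ab] := ltngtP a b.
- by exists a, b; rewrite ab ltn_ord.
- exists b, a; rewrite ba ltn_ord; split=> //.
  by rewrite -opprB diff_setN.
- case/negP: ne; move/val_inj: ab uv => -> /addIr ->; exact: eqxx.
Qed.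

(** The colouring depends on the ring and on E1, but the Ramsey number does
    not, so D is uniform in A.  Colouring pairs of integers, rather than pairs
    of elements of A, makes it possible to divide by b - a and by k: both
    quotients M! / (b - a) and n1! / k are taken before passing to A. *)
Theorem multiples_in_prod_diff_set (n1 n2 : nat) :
  exists2 D : nat, (0 < D)%N &
    forall (A : finComNzRingType) (E1 E2 : {set A}),
    (#|A| < n1 * #|E1|)%N -> (#|A| < n2 * #|E2|)%N ->
    multiples A D \subset prod_set (diff_set E1) (diff_set E2).
Proof.
have [M hM] := Ramsey_pairs nat (fun _ : 'I_n1 => n2).
exists (M`! * n1`!)%N; first by rewrite muln_gt0 !fact_gt0.
move=> A E1 E2 h1 h2; apply/subsetP => _ /imsetP[x _ ->].
have hcol (t : nat) :
    exists k : 'I_n1, (0 < k)%N && ((k * t)%:R \in diff_set E1).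
  have [a [b [/andP[ab bn] d]]] := diff_set_meets (fun j => (j * t)%:R) h1.
  exists (Ordinal (leq_ltn_trans (leq_subr a b) bn)).
  by rewrite /= subn_gt0 ab mulnBl natrB // leq_mul2r (ltnW ab) orbT.
pose col t := xchoose (hcol t).
have [|k [t [st zt pt]]] :=
  hM (fun a b => col (M`! %/ (b - a))%N) (iota 0 M); first by rewrite size_iota.
have t_lt : pairwise ltn t.
  apply: subseq_pairwise st _.
  by rewrite -(sorted_pairwise ltn_trans) iota_ltn_sorted.
pose y (a : nat) := nth 0%N t a.
have [a [b [/andP[ab bn] d2]]] :=
  diff_set_meets (fun a => (y a * (n1`! %/ k))%:R * x) h2.
have [a_t b_t] : (a < size t /\ b < size t)%N.
  by rewrite zt bn (ltn_trans ab bn).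
have yab : (y a < y b)%N by apply: (pairwiseP 0%N t_lt).
have yM : (y b < M)%N.
  have : y b \in iota 0 M by apply: (mem_subseq st); apply: mem_nth.
  by rewrite mem_iota.
have /eqP ck := pairwiseP 0%N pt a b a_t b_t ab.
rewrite -/(y a) -/(y b) in ck.
have /andP[k_gt0 d1] := xchooseP (hcol (M`! %/ (y b - y a))%N).
rewrite -/(col _) ck in k_gt0 d1.
(* The first factor k * (M! / (y b - y a)) falls in E1 - E1, and the second one,
   times x, in E2 - E2. *)
have DE : (M`! * n1`! = k * (M`! %/ (y b - y a)) *
    ((y b - y a) * (n1`! %/ k)))%N.
  have dM : (y b - y a %| M`!)%N.
    by rewrite dvdn_fact // subn_gt0 yab (leq_trans (leq_subr _ _) (ltnW yM)).
  have dn : (k %| n1`!)%N by rewrite dvdn_fact // k_gt0 ltnW.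
  by rewrite -[in LHS](divnK dM) -[in LHS](divnK dn); lia.
rewrite DE natrM -mulrA; apply: imset2_f => //.
by rewrite mulnBl natrB ?mulrBl // leq_mul2r (ltnW yab) orbT.
Qed.

(** By Bezout, gcd(N, D) is a multiple of D modulo N. *)
Lemma multiples_gcdn (N D : nat) : (1 < N)%N ->
  multiples 'Z_N (gcdn N D) \subset multiples 'Z_N D.
Proof.
move=> N1; have [u _ /dvdnP[q hq]] := Bezoutl D (ltnW N1).
have gE : (gcdn N D)%:R = D%:R * - u%:R :> 'Z_N.
  apply/eqP; rewrite mulrN -addr_eq0 -natrM mulnC -natrD hq natrM pchar_Zp //.
  by rewrite mulr0.
by apply/subsetP => _ /imsetP[x _ ->]; rewrite gE -mulrA; apply: imset_f.
Qed.

(** Turns a real density into the integral form of the pigeonhole hypothesis: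
    any integer exceeding 1/alpha will do. *)
Lemma ltn_bound_density (R : archiRealFieldType) (alpha : R) (N m : nat) :
  0 < alpha -> (0 < N)%N -> alpha * N%:R <= m%:R ->
  (N < Num.bound alpha^-1 * m)%N.
Proof.
move=> a0 N0 hm; have a'0 : 0 < alpha^-1 by rewrite invr_gt0.
have hb := archi_boundP (ltW a'0).
have m0 : 0 < m%:R :> R by apply: lt_le_trans hm; rewrite mulr_gt0 ?ltr0n.
rewrite -(ltr_nat R) natrM; apply: le_lt_trans (_ : alpha^-1 * m%:R < _).
  by rewrite mulrC ler_pdivlMr // mulrC.
by rewrite ltr_pM2r.
Qed.

(* 'Z_N is Z/NZ only when 1 < N, so N0 is asked to be at least 2; this does not
   change the claim, since any larger N0 serves equally well. *)
Theorem corollary1p2 (R : realType) (alpha beta : R)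
    (halpha : 0 < alpha) (hbeta : 0 < beta) :
  exists N0 d0 : nat,
    (1 < N0)%N /\ (0 < d0)%N /\
    forall N : nat, (N0 <= N)%N ->
    forall E1 E2 : {set 'Z_N},
      alpha * N%:R <= #|E1|%:R ->
      beta * N%:R <= #|E2|%:R ->
      exists d : nat,
        [/\ (0 < d)%N, (d %| N)%N, (d <= d0)%N &
            multiples 'Z_N d \subset prod_set (diff_set E1) (diff_set E2)].
Proof.
have [D D0 hD] :=
  multiples_in_prod_diff_set (Num.bound alpha^-1) (Num.bound beta^-1).
exists 2%N, D; split=> //; split=> // N N2 E1 E2 hE1 hE2.
have N0 : (0 < N)%N := ltnW N2.
have cN : #|'Z_N| = N by rewrite card_ord Zp_cast.
exists (gcdn N D); split.
- by rewrite gcdn_gt0 N0.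
- exact: dvdn_gcdl.
- by rewrite dvdn_leq // dvdn_gcdr.
- apply: subset_trans (multiples_gcdn D N2) _.
  by apply: hD; rewrite cN ltn_bound_density.
Qed.
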